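(* Let $\theta\in[0,\pi/2]$. Then the inequality $$I_0(t)>\frac{\cosh(t\cos\theta)+\cosh(t\sin\theta)}{2}$$ holds for all $t>0$ if and only if $\theta\in[\pi/8,3\pi/8]$. In particular, $$I_0(t)>\frac12\left(\cosh\frac{\sqrt{2-\sqrt2}\,t}{2}+\cosh\frac{\sqrt{2+\sqrt2}\,t}{2}\right)>\frac12\left(\cosh\frac{\sqrt3\,t}{2}+\cosh\frac t2\right)>\cosh\frac{t}{\sqrt2}$$ for all $t>0$.
   Context: $I_0(t)=\sum_{n=0}^{\infty}\frac{t^{2n}}{2^{2n}(n!)^2}$ denotes the modified Bessel function of the first kind of order $0$. *)

(* Defs.v *)
From Stdlib Require Import Reals Factorial Lra.
From Coquelicot Require Import Coquelicot.
Open Scope R_scope.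

Definition I0_coeff (t : R) (n : nat) : R :=
  t ^ (2 * n) / (2 ^ (2 * n) * (INR (fact n)) ^ 2).

(** Modified Bessel function of the first kind of order 0. *)
Definition I0 (t : R) : R := Series (I0_coeff t).

(** [Series] is total; this shows that [I0 t] is a genuine sum for every [t]. *)
Lemma ex_series_I0 (t : R) : ex_series (I0_coeff t).
Proof.
apply (ex_series_le (I0_coeff t) (fun n => / INR (fact n) * (t ^ 2 / 4) ^ n)).
- intro n.
  assert (Hf : 1 <= INR (fact n)).
  { change 1 with (INR 1). apply le_INR. apply (lt_O_fact n). }
  assert (Hp : 0 <= (t ^ 2 / 4) ^ n).
  { apply pow_le. assert (H := pow2_ge_0 t). lra. }
  assert (E : I0_coeff t n = / (INR (fact n) ^ 2) * (t ^ 2 / 4) ^ n).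
  { unfold I0_coeff, Rdiv. rewrite !pow_mult, Rpow_mult_distr, pow_inv.
    replace (2 ^ 2) with 4 by ring.
    field. split; [apply pow_nonzero; lra | lra]. }
  assert (Hi : 0 < / (INR (fact n) ^ 2)).
  { apply Rinv_0_lt_compat, pow_lt; lra. }
  rewrite E. change (Rabs (/ INR (fact n) ^ 2 * (t ^ 2 / 4) ^ n)
                     <= / INR (fact n) * (t ^ 2 / 4) ^ n).
  rewrite Rabs_pos_eq by (apply Rmult_le_pos; lra).
  apply Rmult_le_compat_r; [exact Hp |].
  apply Rinv_le_contravar; nra.
- exists (exp (t ^ 2 / 4)). apply is_pseries_R, is_exp_Reals.
Qed.

(* Main.v *)
Require Import Defs.
From Stdlib Require Import Reals Factorial Lra Lia.
From Coquelicot Require Import Coquelicot.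
Open Scope R_scope.

(** All the functions involved are even power series in [t], so they are
    compared coefficient by coefficient against [(t^2)^n / (2n)!].  The
    coefficients of [I0] are [w n = binom(2n, n) / 4^n], and those of
    [(cosh (t cos theta) + cosh (t sin theta)) / 2] are
    [b n = (c^n + s^n) / 2] with [c = cos^2 theta], [s = sin^2 theta].
    Since [c + s = 1], [b 2] and [b 3] depend only on [c s], and
    [w 2 - b 2 = c s - 1/8], [w 3 - b 3 = (3/2) (c s - 1/8)], while the
    coefficients of index 0 and 1 agree.  The threshold is thus [c s = 1/8],
    and [cos (4 theta) = 1 - 8 c s] turns it into the interval of angles.

    If [c s >= 1/8], both [c] and [s] are smaller than [7/8], so [b] decreases
    by a factor smaller than [7/8] at each step; [w] decreases by the factor
    [(2n+1)/(2n+2)], which is at least [7/8] from [n = 3] on.  Hence [b n < w n]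
    for all [n >= 4] ([cosh_mean_coeff_lt], [I0_gt_cosh_mean]).  If
    [c s < 1/8], the coefficient of [t^4] has the wrong sign and the inequality
    fails for small [t] ([I0_lt_cosh_mean_small]).

    The other two inequalities compare means of the same kind, for products
    [c s] equal to [1/8], [3/16] and [1/4]: spreading [c] and [s] apart with
    their sum fixed never decreases [c^n + s^n], by convexity
    ([pow_sum_spread]), and increases it for [n = 2]. *)

(** * Comparison of series *)

Lemma is_series_nonneg_ge_sum (a : nat -> R) (l : R) (N : nat) :
  (forall n, 0 <= a n) -> is_series a l -> sum_f_R0 a N <= l.
Proof.
intros Ha Hl. apply (sum_incr a N l); [|exact Ha].
apply is_series_Reals in Hl. exact Hl.
Qed.

Lemma is_series_lt (a b : nat -> R) (la lb : R) (k : nat) :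
  is_series a la -> is_series b lb -> (forall n, a n <= b n) -> a k < b k ->
  la < lb.
Proof.
intros Ha Hb Hle Hk.
assert (Hd : is_series (fun n => b n - a n) (lb - la))
  by exact (is_series_minus _ _ _ _ Hb Ha).
assert (Hpos : forall n, 0 <= b n - a n) by (intro n; specialize (Hle n); lra).
assert (H := is_series_nonneg_ge_sum _ _ k Hpos Hd).
assert (Hs : b k - a k <= sum_f_R0 (fun n => b n - a n) k).
{ destruct k as [|k]; [simpl; lra|].
  rewrite tech5.
  assert (H0 := cond_pos_sum (fun n => b n - a n) k Hpos). lra. }
lra.
Qed.

(** * Even power series of [cosh] *)

Lemma INR_fact_pos (n : nat) : 0 < INR (fact n).
Proof. apply lt_0_INR, lt_O_fact. Qed.

(** Covers both the even and the odd part of the exponential series: their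
    terms are dominated by those of the series of [exp y]. *)
Lemma ex_series_sparse_exp (y : R) (phi : nat -> nat) :
  0 <= y -> (forall n, (n <= phi n)%nat) ->
  ex_series (fun n => y ^ n * / INR (fact (phi n))).
Proof.
intros Hy Hphi.
apply (ex_series_le (fun n => y ^ n * / INR (fact (phi n)))
                    (fun n => / INR (fact n) * y ^ n)).
- intro n.
  assert (Hp : 0 <= y ^ n) by (apply pow_le; lra).
  assert (H1 := INR_fact_pos n). assert (H2 := INR_fact_pos (phi n)).
  assert (H3 := Rinv_0_lt_compat _ H2).
  change (Rabs (y ^ n * / INR (fact (phi n))) <= / INR (fact n) * y ^ n).
  rewrite Rabs_pos_eq by (apply Rmult_le_pos; lra).
  rewrite Rmult_comm. apply Rmult_le_compat_r; [exact Hp|].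
  apply Rinv_le_contravar; [exact H1|].
  apply le_INR, fact_le, Hphi.
- exists (exp y). apply is_pseries_R, is_exp_Reals.
Qed.

(** With [Ev] and [Od] the sums of the even and odd parts of the exponential
    series, [exp x = Ev + x Od] and [exp (- x) = Ev - x Od]; averaging leaves
    [Ev]. *)
Lemma is_series_cosh (x : R) :
  is_series (fun n => (x ^ 2) ^ n * / INR (fact (2 * n))) (cosh x).
Proof.
assert (Hx : 0 <= x ^ 2) by apply pow2_ge_0.
destruct (ex_series_sparse_exp (x ^ 2) (fun n => 2 * n)%nat Hx) as [Ev HE];
  [intro n; lia|].
destruct (ex_series_sparse_exp (x ^ 2) (fun n => 2 * n + 1)%nat Hx) as [Od HO];
  [intro n; lia|].
assert (split_exp : forall z, z ^ 2 = x ^ 2 -> exp z = Ev + z * Od).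
{ intros z Hz.
  assert (HE' : is_pseries (fun n => / INR (fact (2 * n))) (z ^ 2) Ev).
  { apply is_pseries_R. rewrite Hz.
    eapply is_series_ext; [|exact HE]. intro n. apply Rmult_comm. }
  assert (HO' : is_pseries (fun n => / INR (fact (2 * n + 1))) (z ^ 2) Od).
  { apply is_pseries_R. rewrite Hz.
    eapply is_series_ext; [|exact HO]. intro n. apply Rmult_comm. }
  assert (H := is_pseries_odd_even (fun n => / INR (fact n)) z Ev Od HE' HO').
  rewrite <- (is_pseries_unique _ _ _ H).
  symmetry. apply is_pseries_unique, is_exp_Reals. }
assert (E : cosh x = Ev).
{ unfold cosh. rewrite (split_exp x eq_refl), (split_exp (- x)) by ring. field. }
rewrite E. exact HE.
Qed.

Lemma is_series_cosh_mean (c s t x y : R) :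
  x ^ 2 = c * t ^ 2 -> y ^ 2 = s * t ^ 2 ->
  is_series (fun n => (c ^ n + s ^ n) / 2 * ((t ^ 2) ^ n * / INR (fact (2 * n))))
            ((cosh x + cosh y) / 2).
Proof.
intros Hx Hy.
assert (H := is_series_scal (/ 2) _ _
  (is_series_plus _ _ _ _ (is_series_cosh x) (is_series_cosh y))).
change (is_series (fun n => / 2 * ((x ^ 2) ^ n * / INR (fact (2 * n))
                                  + (y ^ 2) ^ n * / INR (fact (2 * n))))
                  (/ 2 * (cosh x + cosh y))) in H.
replace ((cosh x + cosh y) / 2) with (/ 2 * (cosh x + cosh y))
  by apply Rmult_comm.
assert (E : forall n, / 2 * ((x ^ 2) ^ n * / INR (fact (2 * n))
                            + (y ^ 2) ^ n * / INR (fact (2 * n)))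
  = (c ^ n + s ^ n) / 2 * ((t ^ 2) ^ n * / INR (fact (2 * n)))).
{ intro n. rewrite Hx, Hy, !Rpow_mult_distr. field.
  apply Rgt_not_eq, INR_fact_pos. }
exact (is_series_ext _ _ _ E H).
Qed.

Lemma even_monomial_pos (t : R) (n : nat) :
  0 < t -> 0 < (t ^ 2) ^ n * / INR (fact (2 * n)).
Proof.
intro Ht. apply Rmult_lt_0_compat.
- apply pow_lt, pow_lt, Ht.
- apply Rinv_0_lt_compat, INR_fact_pos.
Qed.

(** * Lower bound for [I0] above the threshold *)

(** This is [binom(2n, n) / 4^n], written so that it is the coefficient of
    [(t^2)^n / (2n)!] in [I0]. *)
Definition central_ratio (n : nat) : R :=
  INR (fact (2 * n)) / (4 ^ n * INR (fact n) ^ 2).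

Lemma I0_coeff_central_ratio (t : R) (n : nat) :
  I0_coeff t n = central_ratio n * ((t ^ 2) ^ n * / INR (fact (2 * n))).
Proof.
unfold I0_coeff, central_ratio. rewrite !pow_mult.
replace (2 ^ 2) with 4 by ring.
field. repeat split.
- apply Rgt_not_eq, INR_fact_pos.
- apply Rgt_not_eq, INR_fact_pos.
- apply pow_nonzero; lra.
Qed.

Lemma central_ratio_0 : central_ratio 0 = 1.
Proof. unfold central_ratio. simpl. field. Qed.

Lemma central_ratio_S (n : nat) :
  central_ratio (S n)
  = central_ratio n * ((2 * INR n + 1) / (2 * INR n + 2)).
Proof.
unfold central_ratio.
replace (2 * S n)%nat with (S (S (2 * n))) by lia.
rewrite !fact_simpl, !mult_INR, !S_INR, mult_INR.
change (4 ^ S n) with (4 * 4 ^ n). change (INR 2) with 2.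
assert (H1 := INR_fact_pos n). assert (H2 := pos_INR n).
field. repeat split; try lra. apply pow_nonzero; lra.
Qed.

Lemma central_ratio_pos (n : nat) : 0 < central_ratio n.
Proof.
unfold central_ratio. apply Rdiv_lt_0_compat; [apply INR_fact_pos|].
apply Rmult_lt_0_compat; apply pow_lt; [lra | apply INR_fact_pos].
Qed.

Lemma central_ratio_1 : central_ratio 1 = 1 / 2.
Proof. rewrite central_ratio_S, central_ratio_0. simpl. field. Qed.

Lemma central_ratio_2 : central_ratio 2 = 3 / 8.
Proof. rewrite central_ratio_S, central_ratio_1. simpl. field. Qed.

Lemma central_ratio_3 : central_ratio 3 = 5 / 16.
Proof. rewrite central_ratio_S, central_ratio_2. simpl. field. Qed.

Lemma central_ratio_slow_decrease (n : nat) :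
  (3 <= n)%nat -> 7 / 8 * central_ratio n <= central_ratio (S n).
Proof.
intro Hn. rewrite central_ratio_S, Rmult_comm.
apply Rmult_le_compat_l; [left; apply central_ratio_pos|].
apply le_INR in Hn. simpl in Hn.
apply Rmult_le_reg_r with (2 * INR n + 2); [lra|].
unfold Rdiv at 2. rewrite Rmult_assoc, Rinv_l; lra.
Qed.

(** If [c >= 7/8], then [c (1 - c) <= 7/64 < 1/8]. *)
Lemma lt_7_8_of_product (c s : R) : c + s = 1 -> 1 / 8 <= c * s -> c < 7 / 8.
Proof. intros. nra. Qed.

Lemma pow_sum_fast_decrease (c s : R) (n : nat) :
  0 <= c -> 0 <= s -> c + s = 1 -> 1 / 8 <= c * s ->
  (c ^ S n + s ^ S n) / 2 < 7 / 8 * ((c ^ n + s ^ n) / 2).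
Proof.
intros Hc Hs Hsum Hprod.
assert (c < 7 / 8) by (apply (lt_7_8_of_product c s); assumption).
assert (s < 7 / 8) by (apply (lt_7_8_of_product s c); lra).
assert (Hcp : 0 < c ^ n) by (apply pow_lt; nra).
assert (Hsp : 0 < s ^ n) by (apply pow_lt; nra).
simpl. nra.
Qed.

(** The equality case [c s = 1/8] makes [n = 3] an equality as well, so strict
    inequality starts at [n = 4]. *)
Lemma cosh_mean_coeff_lt (c s : R) (n : nat) :
  0 <= c -> 0 <= s -> c + s = 1 -> 1 / 8 <= c * s ->
  (c ^ (4 + n) + s ^ (4 + n)) / 2 < central_ratio (4 + n).
Proof.
intros Hc Hs Hsum Hprod.
assert (step : forall k, (3 <= k)%nat ->
  (c ^ k + s ^ k) / 2 <= central_ratio k ->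
  (c ^ S k + s ^ S k) / 2 < central_ratio (S k)).
{ intros k Hk IH.
  assert (H1 := pow_sum_fast_decrease c s k Hc Hs Hsum Hprod).
  assert (H2 := central_ratio_slow_decrease k Hk). lra. }
induction n as [|n IHn].
- apply (step 3%nat); [lia|]. rewrite central_ratio_3.
  replace s with (1 - c) in * by lra. simpl. nra.
- apply (step (4 + n)%nat); [lia | left; exact IHn].
Qed.

Lemma cosh_mean_coeff_le (c s : R) (n : nat) :
  0 <= c -> 0 <= s -> c + s = 1 -> 1 / 8 <= c * s ->
  (c ^ n + s ^ n) / 2 <= central_ratio n.
Proof.
intros Hc Hs Hsum Hprod.
destruct n as [|[|[|[|n]]]].
- rewrite central_ratio_0. simpl. lra.
- rewrite central_ratio_1. simpl. lra.
- rewrite central_ratio_2. replace s with (1 - c) in * by lra. simpl. nra.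
- rewrite central_ratio_3. replace s with (1 - c) in * by lra. simpl. nra.
- left. apply (cosh_mean_coeff_lt c s n); assumption.
Qed.

Lemma I0_gt_cosh_mean (c s t x y : R) :
  0 <= c -> 0 <= s -> c + s = 1 -> 1 / 8 <= c * s ->
  0 < t -> x ^ 2 = c * t ^ 2 -> y ^ 2 = s * t ^ 2 ->
  (cosh x + cosh y) / 2 < I0 t.
Proof.
intros Hc Hs Hsum Hprod Ht Hx Hy.
assert (HI := Series_correct _ (ex_series_I0 t)).
apply (is_series_lt _ _ _ _ 4 (is_series_cosh_mean c s t x y Hx Hy) HI).
- intro n. rewrite I0_coeff_central_ratio.
  apply Rmult_le_compat_r; [left; apply even_monomial_pos, Ht|].
  apply cosh_mean_coeff_le; assumption.
- rewrite I0_coeff_central_ratio.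
  apply Rmult_lt_compat_r; [apply even_monomial_pos, Ht|].
  apply (cosh_mean_coeff_lt c s 0); assumption.
Qed.

(** * Failure below the threshold *)

(** For [t <= 1], the terms of index [n >= 3] are at most [t^6 / 4^n], and
    [t^6 / 48] is the sum of that geometric tail. *)
Lemma I0_le_small (t : R) :
  0 < t <= 1 -> I0 t <= 1 + t ^ 2 / 4 + t ^ 4 / 64 + t ^ 6 / 48.
Proof.
intros [Ht0 Ht1]. unfold I0.
rewrite (Series_incr_n _ 3); [|lia|apply ex_series_I0].
assert (Hgeom : is_series (fun k => t ^ 6 / 64 * (/ 4) ^ k)
                          (t ^ 6 / 64 * / (1 - / 4))).
{ apply (is_series_scal (t ^ 6 / 64) (fun k => (/ 4) ^ k)), is_series_geom.
  rewrite Rabs_pos_eq; lra. }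
assert (Htail : Series (fun k => I0_coeff t (3 + k)) <= t ^ 6 / 48).
{ replace (t ^ 6 / 48) with (t ^ 6 / 64 * / (1 - / 4)) by field.
  rewrite <- (is_series_unique _ _ Hgeom).
  apply Series_le; [|eexists; exact Hgeom].
  intro k. unfold I0_coeff.
  assert (Hf : 1 <= INR (fact (3 + k)) ^ 2).
  { apply pow_R1_Rle. change 1 with (INR 1). apply le_INR, (lt_O_fact (3 + k)). }
  assert (H4 : 0 < 4 ^ k) by (apply pow_lt; lra).
  assert (Htk : 0 < (t ^ 2) ^ k) by (apply pow_lt, pow_lt, Ht0).
  assert (Htk1 : (t ^ 2) ^ k <= 1).
  { rewrite <- (pow1 k). apply pow_incr. nra. }
  assert (Ht6 : 0 < t ^ 6) by (apply pow_lt, Ht0).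
  assert (Hf' : 0 < / INR (fact (3 + k)) ^ 2) by (apply Rinv_0_lt_compat; lra).
  assert (Hf1 : / INR (fact (3 + k)) ^ 2 <= 1).
  { rewrite <- Rinv_1. apply Rinv_le_contravar; lra. }
  replace (t ^ (2 * (3 + k)) / (2 ^ (2 * (3 + k)) * INR (fact (3 + k)) ^ 2))
    with (t ^ 6 / 64 * (/ 4) ^ k * ((t ^ 2) ^ k * / INR (fact (3 + k)) ^ 2)).
  2: { replace (2 * (3 + k))%nat with (6 + 2 * k)%nat by lia.
       rewrite !pow_add, !pow_mult, pow_inv.
       replace (2 ^ 2) with 4 by ring. field.
       split; apply Rgt_not_eq; [apply INR_fact_pos | lra]. }
  assert (Hg : 0 < t ^ 6 / 64 * (/ 4) ^ k).
  { apply Rmult_lt_0_compat; [lra|]. apply pow_lt; lra. }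
  split; [left; repeat apply Rmult_lt_0_compat; lra || auto with real|].
  rewrite <- (Rmult_1_r (t ^ 6 / 64 * (/ 4) ^ k)) at 2.
  apply Rmult_le_compat_l; [lra|]. nra. }
assert (Hhead : sum_f_R0 (I0_coeff t) (pred 3) = 1 + t ^ 2 / 4 + t ^ 4 / 64).
{ unfold I0_coeff. simpl. field. }
rewrite Hhead. lra.
Qed.

Lemma cosh_mean_ge_quartic (c s t x y : R) :
  0 <= c -> 0 <= s -> c + s = 1 -> 0 < t ->
  x ^ 2 = c * t ^ 2 -> y ^ 2 = s * t ^ 2 ->
  1 + t ^ 2 / 4 + (1 - 2 * (c * s)) / 48 * t ^ 4 <= (cosh x + cosh y) / 2.
Proof.
intros Hc Hs Hsum Ht Hx Hy.
assert (Hpos : forall n,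
  0 <= (c ^ n + s ^ n) / 2 * ((t ^ 2) ^ n * / INR (fact (2 * n)))).
{ intro n. apply Rmult_le_pos; [|left; apply even_monomial_pos, Ht].
  assert (H1 := pow_le c n Hc). assert (H2 := pow_le s n Hs). lra. }
assert (H := is_series_nonneg_ge_sum _ _ 2 Hpos
  (is_series_cosh_mean c s t x y Hx Hy)).
replace s with (1 - c) in * by lra.
eapply Rle_trans; [|exact H]. right. simpl. field.
Qed.

(** The gap in the coefficient of [t^4] is [d / 48] with [d = 1/4 - 2 c s], and
    the tail of [I0] costs at most [t^6 / 48]; so [t^2 < d] suffices, and
    [t = d] achieves it because [d < 1]. *)
Lemma I0_lt_cosh_mean_small (c s : R) :
  0 <= c -> 0 <= s -> c + s = 1 -> c * s < 1 / 8 ->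
  exists t, 0 < t /\ forall x y,
    x ^ 2 = c * t ^ 2 -> y ^ 2 = s * t ^ 2 -> I0 t < (cosh x + cosh y) / 2.
Proof.
intros Hc Hs Hsum Hprod.
set (d := 1 / 4 - 2 * (c * s)).
assert (Hcs : 0 <= c * s) by (apply Rmult_le_pos; assumption).
assert (Hd : 0 < d <= 1 / 4) by (unfold d; lra).
exists d. split; [apply Hd|]. intros x y Hx Hy.
assert (H1 := I0_le_small d ltac:(lra)).
assert (H2 := cosh_mean_ge_quartic c s d x y Hc Hs Hsum (proj1 Hd) Hx Hy).
assert (Hd4 : 0 < d ^ 4) by (apply pow_lt, Hd).
replace (1 - 2 * (c * s)) with (3 / 4 + d) in H2 by (unfold d; field).
assert (Hgap : 0 < d ^ 4 * (d - d ^ 2)) by (apply Rmult_lt_0_compat; nra).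
assert (d ^ 6 = d ^ 4 * d ^ 2) by ring. nra.
Qed.

(** * Comparison of two means of hyperbolic cosines *)

(** Convexity of the power: increments over steps of equal length
    [u - w = z - v] are larger further to the right. *)
Lemma pow_sum_spread (u v w z : R) (n : nat) :
  0 <= v -> v <= w <= u -> u + v = w + z -> w ^ n + z ^ n <= u ^ n + v ^ n.
Proof.
intros Hv Hw Hsum.
induction n as [|n IHn]; [simpl; lra|].
assert (Hvw : v ^ n <= w ^ n) by (apply pow_incr; lra).
assert (Hvz : v ^ n <= z ^ n) by (apply pow_incr; lra).
assert (E : u ^ S n + v ^ S n - (w ^ S n + z ^ S n)
  = u * (u ^ n - w ^ n) - z * (z ^ n - v ^ n) + (u - w) * (w ^ n - v ^ n)).
{ simpl. replace z with (u + v - w) by lra. ring. }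
assert (0 <= (u - w) * (w ^ n - v ^ n)) by (apply Rmult_le_pos; lra).
assert (z * (z ^ n - v ^ n) <= u * (u ^ n - w ^ n))
  by (apply Rmult_le_compat; lra).
lra.
Qed.

Lemma cosh_mean_spread_lt (u v w z t x y x' y' : R) :
  0 <= v -> v < w < u -> u + v = w + z -> 0 < t ->
  x ^ 2 = w * t ^ 2 -> y ^ 2 = z * t ^ 2 ->
  x' ^ 2 = u * t ^ 2 -> y' ^ 2 = v * t ^ 2 ->
  (cosh x + cosh y) / 2 < (cosh x' + cosh y') / 2.
Proof.
intros Hv Hw Hsum Ht Hx Hy Hx' Hy'.
apply (is_series_lt _ _ _ _ 2 (is_series_cosh_mean w z t x y Hx Hy)
         (is_series_cosh_mean u v t x' y' Hx' Hy')).
- intro n. apply Rmult_le_compat_r; [left; apply even_monomial_pos, Ht|].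
  assert (H := pow_sum_spread u v w z n Hv ltac:(lra) Hsum). lra.
- apply Rmult_lt_compat_r; [apply even_monomial_pos, Ht|].
  assert (0 < (u - w) * (w - v)) by (apply Rmult_lt_0_compat; lra).
  replace z with (u + v - w) by lra. nra.
Qed.

(** * The interval of angles *)

Lemma cos_4_eq (theta : R) :
  cos (4 * theta) = 1 - 8 * (cos theta ^ 2 * sin theta ^ 2).
Proof.
replace (4 * theta) with (2 * (2 * theta)) by ring.
rewrite cos_2a_sin, sin_2a. ring.
Qed.

Lemma cos2_sin2_ge_iff (theta : R) :
  0 <= theta <= PI / 2 ->
  (1 / 8 <= cos theta ^ 2 * sin theta ^ 2
   <-> PI / 8 <= theta <= 3 * PI / 8).
Proof.
intros Ht. assert (Hpi := PI_RGT_0). assert (E := cos_4_eq theta).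
split.
- intros H. split.
  + destruct (Rle_lt_dec (PI / 8) theta) as [|Hlt]; [assumption|exfalso].
    assert (0 < cos (4 * theta)) by (apply cos_gt_0; lra). lra.
  + destruct (Rle_lt_dec theta (3 * PI / 8)) as [|Hlt]; [assumption|exfalso].
    assert (H0 : 0 < cos (4 * theta - 2 * PI)) by (apply cos_gt_0; lra).
    rewrite <- (cos_period _ 1) in H0. simpl INR in H0.
    replace (4 * theta - 2 * PI + 2 * 1 * PI) with (4 * theta) in H0 by ring.
    lra.
- intros H. assert (cos (4 * theta) <= 0) by (apply cos_le_0; lra). lra.
Qed.

Theorem theorem7 :
  (forall theta : R, 0 <= theta <= PI / 2 ->
     ((forall t : R, 0 < t ->
         I0 t > (cosh (t * cos theta) + cosh (t * sin theta)) / 2)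
      <-> PI / 8 <= theta <= 3 * PI / 8)) /\
  (forall t : R, 0 < t ->
     I0 t > 1 / 2 * (cosh (sqrt (2 - sqrt 2) * t / 2)
                     + cosh (sqrt (2 + sqrt 2) * t / 2)) /\
     1 / 2 * (cosh (sqrt (2 - sqrt 2) * t / 2)
              + cosh (sqrt (2 + sqrt 2) * t / 2))
       > 1 / 2 * (cosh (sqrt 3 * t / 2) + cosh (t / 2)) /\
     1 / 2 * (cosh (sqrt 3 * t / 2) + cosh (t / 2)) > cosh (t / sqrt 2)).
Proof.
split.
- intros theta Htheta.
  assert (Hsum : cos theta ^ 2 + sin theta ^ 2 = 1).
  { assert (H := sin2_cos2 theta). unfold Rsqr in H. simpl. lra. }
  assert (Hc := pow2_ge_0 (cos theta)). assert (Hs := pow2_ge_0 (sin theta)).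
  rewrite <- (cos2_sin2_ge_iff theta Htheta). split.
  + intros H.
    destruct (Rle_lt_dec (1 / 8) (cos theta ^ 2 * sin theta ^ 2)) as [|Hlt];
      [assumption|exfalso].
    destruct (I0_lt_cosh_mean_small _ _ Hc Hs Hsum Hlt) as [t [Ht Hless]].
    specialize (H t Ht).
    assert (I0 t < (cosh (t * cos theta) + cosh (t * sin theta)) / 2)
      by (apply Hless; ring).
    lra.
  + intros Hprod t Ht.
    apply (I0_gt_cosh_mean _ _ t _ _ Hc Hs Hsum Hprod Ht); ring.
- intros t Ht.
  assert (H2 : sqrt 2 * sqrt 2 = 2) by (apply sqrt_sqrt; lra).
  assert (H3 : sqrt 3 ^ 2 = 3) by (apply pow2_sqrt; lra).
  assert (H2pos : 0 < sqrt 2) by (apply sqrt_lt_R0; lra).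
  assert (H2b : 1 < sqrt 2 < 2) by nra.
  assert (Hm : (sqrt (2 - sqrt 2) * t / 2) ^ 2 = (2 - sqrt 2) / 4 * t ^ 2).
  { assert (H := pow2_sqrt (2 - sqrt 2) ltac:(lra)).
    transitivity (sqrt (2 - sqrt 2) ^ 2 * t ^ 2 / 4); [field|].
    rewrite H. field. }
  assert (Hp : (sqrt (2 + sqrt 2) * t / 2) ^ 2 = (2 + sqrt 2) / 4 * t ^ 2).
  { assert (H := pow2_sqrt (2 + sqrt 2) ltac:(lra)).
    transitivity (sqrt (2 + sqrt 2) ^ 2 * t ^ 2 / 4); [field|].
    rewrite H. field. }
  assert (H34 : (sqrt 3 * t / 2) ^ 2 = 3 / 4 * t ^ 2).
  { transitivity (sqrt 3 ^ 2 * t ^ 2 / 4); [field|]. rewrite H3. field. }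
  assert (H14 : (t / 2) ^ 2 = 1 / 4 * t ^ 2) by field.
  assert (H12 : (t / sqrt 2) ^ 2 = 1 / 2 * t ^ 2).
  { replace (1 / 2) with (/ (sqrt 2 * sqrt 2)) by (rewrite H2; field).
    field. lra. }
  split; [|split].
  + assert (H := I0_gt_cosh_mean ((2 - sqrt 2) / 4) ((2 + sqrt 2) / 4) t _ _
      ltac:(lra) ltac:(lra) ltac:(lra) ltac:(nra) Ht Hm Hp). lra.
  + assert (H := cosh_mean_spread_lt ((2 + sqrt 2) / 4) ((2 - sqrt 2) / 4)
      (3 / 4) (1 / 4) t _ _ _ _
      ltac:(lra) ltac:(lra) ltac:(lra) Ht H34 H14 Hp Hm). lra.
  + assert (H := cosh_mean_spread_lt (3 / 4) (1 / 4) (1 / 2) (1 / 2) t _ _ _ _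
      ltac:(lra) ltac:(lra) ltac:(lra) Ht H12 H12 H34 H14). lra.
Qed.
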